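(* Let $\mathbb{P}^n_s$ be a finite positive spanning set of $\mathbb{R}^n$. Then the cosine measure algorithm described in the context returns the exact value of the cosine measure $\operatorname{cm}(\mathbb{P}^n_s)$; that is, $$\operatorname{cm}(\mathbb{P}^n_s)=\min_{\mathbf{B}\subset\mathbb{P}^n_s}\ \mathring{p}_{\mathbf{B}},$$ where the minimum is over all bases $\mathbf{B}$ of $\mathbb{R}^n$ contained in $\mathbb{P}^n_s$ and $\mathring{p}_{\mathbf{B}}$ is the quantity computed by the algorithm for $\mathbf{B}$.
   Context: The positive span of a finite set $S=\{d_1,\dots,d_s\}\subset\mathbb{R}^n$ is $\operatorname{pspan}(S)=\{\alpha_1d_1+\dots+\alpha_sd_s:\alpha_i\ge 0,\ i=1,\dots,s\}$. A finite positive spanning set of $\mathbb{R}^n$ of size $s$, denoted $\mathbb{P}^n_s$, is a set of $s$ nonzero vectors whose positive span is $\mathbb{R}^n$. A finite set of vectors is also regarded as the matrix whose columns are its vectors. $\|\cdot\|$ is the Euclidean norm. The cosine measure of a positive spanning set is $$\operatorname{cm}(\mathbb{P}^n_s)=\min_{u\in\mathbb{R}^n,\ \|u\|=1}\ \max_{d\in\mathbb{P}^n_s}\frac{u^\top d}{\|d\|}.$$ The Gram matrix of a set of vectors $\{d_1,\dots,d_m\}$ is the $m\times m$ matrix $\mathbf{G}$ with entries $d_i^\top d_j$. $\mathbf{1}\in\mathbb{R}^n$ is the all-ones vector. Cosine measure algorithm. Given a finite positive spanning set $\mathbb{P}^n_s$ of $\mathbb{R}^n$: Step 1. For all bases $\mathbf{B}\subset\mathbb{P}^n_s$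 of $\mathbb{R}^n$, compute (1.1) $\gamma_{\mathbf{B}}=\dfrac{1}{\sqrt{\mathbf{1}^\top\mathbf{G}(\mathbf{B})^{-1}\mathbf{1}}}$, where $\mathbf{G}(\mathbf{B})$ is the Gram matrix of $\mathbf{B}$; (1.2) $u_{\mathbf{B}}=\mathbf{B}^{-\top}\gamma_{\mathbf{B}}\mathbf{1}$; (1.3) $p_{\mathbf{B}}=[\,p_{\mathbf{B}}^1\ \cdots\ p_{\mathbf{B}}^s\,]=u_{\mathbf{B}}^\top\mathbb{P}^n_s$; (1.4) $\mathring{p}_{\mathbf{B}}=\max_{1\le i\le s}p_{\mathbf{B}}^i$. Step 2. Return (2.1) as the cosine measure of $\mathbb{P}^n_s$, the value $\min_{\mathbf{B}\subset\mathbb{P}^n_s}\mathring{p}_{\mathbf{B}}$ (minimum over all bases of $\mathbb{R}^n$ contained in $\mathbb{P}^n_s$); (2.2) as the cosine vector set of $\mathbb{P}^n_s$ (the set of unit vectors $u$ attaining the minimum in the definition of the cosine measure), the set of those $u_{\mathbf{B}}$ for which $\mathring{p}_{\mathbf{B}}$ equals the value returned in (2.1).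
   Formalization: As stated the claim fails for non-unit vectors (for {2,−2} in R^1 the algorithm gives 2, but cm = 1), so the algorithm is run on the normalized vectors d/‖d‖; for unit vectors this is the literal claim. n ≥ 1 is assumed. *)

(* Defs.v *)
From mathcomp Require Import all_boot all_order all_algebra.
From mathcomp Require Import all_classical all_reals.

Set Implicit Arguments.
Unset Strict Implicit.
Unset Printing Implicit Defensive.

Import Order.TTheory GRing.Theory Num.Theory.
Local Open Scope classical_set_scope.
Local Open Scope ring_scope.

Section CosineMeasure.
Context {R : realType}.

Definition is_minimum (A : set R) (m : R) : Prop := A m /\ lbound A m.

(* The default value [head 0 l] makes this the maximum of the entries of [l]
   whenever [l] is nonempty; it is 0 for the empty sequence. *)
Definition seq_max (l : seq R) : R := \big[Num.max/head 0 l]_(x <- l) x.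

Definition dot n (u v : 'cV[R]_n) : R := (u^T *m v) 0 0.

(* The norm [`| |] that MathComp-Analysis puts on matrices is the sup norm. *)
Definition enorm n (u : 'cV[R]_n) : R := Num.sqrt (dot u u).

Definition normalize n (u : 'cV[R]_n) : 'cV[R]_n := (enorm u)^-1 *: u.

Definition pspan n s (S : s.-tuple 'cV[R]_n) : set 'cV[R]_n :=
  [set x | exists a : 'I_s -> R,
     (forall i, 0 <= a i) /\ x = \sum_(i < s) a i *: tnth S i].

Definition positive_spanning_set n s (P : s.-tuple 'cV[R]_n) : Prop :=
  [/\ uniq P, 0 \notin P & pspan P = setT].

Definition is_cosine_measure n s (P : s.-tuple 'cV[R]_n) (c : R) : Prop :=
  is_minimum
    [set seq_max [seq dot u d / enorm d | d <- P] | u in [set u | enorm u = 1]]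
    c.

Definition cols n m (B : m.-tuple 'cV[R]_n) : 'M[R]_(n, m) :=
  \matrix_(i < n, j < m) tnth B j i 0.

Definition gram n m (B : m.-tuple 'cV[R]_n) : 'M[R]_m :=
  \matrix_(i < m, j < m) dot (tnth B i) (tnth B j).

(* A basis is listed as a tuple, so each one occurs once per ordering of its
   vectors; [basis_max] below does not depend on the ordering. *)
Definition bases n s (P : s.-tuple 'cV[R]_n) : set (n.-tuple 'cV[R]_n) :=
  [set B | basis_of {:'cV[R]_n} B /\ {subset B <= P}].

Definition basis_gamma n (B : n.-tuple 'cV[R]_n) : R :=
  let ones : 'cV[R]_n := const_mx 1 in
  1 / Num.sqrt ((ones^T *m invmx (gram B) *m ones) 0 0).

Definition basis_vec n (B : n.-tuple 'cV[R]_n) : 'cV[R]_n :=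
  (invmx (cols B))^T *m (basis_gamma B *: const_mx 1).

Definition basis_row n s (P : s.-tuple 'cV[R]_n) (B : n.-tuple 'cV[R]_n) :
  'rV[R]_s := (basis_vec B)^T *m cols P.

Definition basis_max n s (P : s.-tuple 'cV[R]_n) (B : n.-tuple 'cV[R]_n) : R :=
  seq_max [seq basis_row P B 0 i | i : 'I_s].

Definition cm_algorithm_returns n s (P : s.-tuple 'cV[R]_n) (c : R) : Prop :=
  is_minimum [set basis_max P B | B in bases P] c.

(* The cosine measure is invariant under positive rescaling of the individual
   vectors, but the formulas of the algorithm are not: on {2, -2} in R^1 they
   give 2, whereas the cosine measure is 1.  They are meant for unit vectors,
   so the algorithm has to be run on the normalized vectors. *)
Definition unit_vectors n s (P : s.-tuple 'cV[R]_n) : s.-tuple 'cV[R]_n :=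
  map_tuple (@normalize n) P.

Lemma unit_vectors_id n s (P : s.-tuple 'cV[R]_n) :
  (forall d, d \in P -> enorm d = 1) -> unit_vectors P = P.
Proof.
move=> P1; apply: val_inj => /=; rewrite -[RHS]map_id.
by apply/eq_in_map => d /P1 d1; rewrite /normalize d1 invr1 scale1r.
Qed.

End CosineMeasure.

(* Main.v *)
Require Import Defs.
From mathcomp Require Import all_boot all_order all_algebra.
From mathcomp Require Import all_classical all_reals.

(* For a unit vector u with maximum c > 0 over the normalized vectors q, the
   point u / c lies in the polytope {v | v . q <= 1 for all q}.  Moving it along
   directions orthogonal to its active constraints never shortens it and ends at
   a vertex v, whose active constraints contain a basis B.  The algorithm's
   vector u_B is then v / |v|, with maximum at most 1 / |v| <= c.  As every u_B
   is a unit vector and there are finitely many bases, both minima exist and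
   agree. *)

Set Implicit Arguments.
Unset Strict Implicit.
Unset Printing Implicit Defensive.

Import Order.TTheory GRing.Theory Num.Theory.
Local Open Scope classical_set_scope.
Local Open Scope ring_scope.

(** * Euclidean inner product and norm *)

Section Dot.
Context {R : realType} {n : nat}.
Implicit Types (u v w : 'cV[R]_n) (a : R).

Lemma dotE u v : dot u v = \sum_i u i 0 * v i 0.
Proof. by rewrite /dot mxE; apply: eq_bigr => i _; rewrite mxE. Qed.

Lemma dotC u v : dot u v = dot v u.
Proof. by rewrite !dotE; apply: eq_bigr => i _; rewrite mulrC. Qed.

Lemma dotDl u v w : dot (u + v) w = dot u w + dot v w.
Proof. by rewrite /dot linearD /= mulmxDl mxE. Qed.

Lemma dotZl a u v : dot (a *: u) v = a * dot u v.
Proof. by rewrite /dot linearZ /= -scalemxAl mxE. Qed.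

Lemma dotDr u v w : dot u (v + w) = dot u v + dot u w.
Proof. by rewrite /dot mulmxDr mxE. Qed.

Lemma dotZr a u v : dot u (a *: v) = a * dot u v.
Proof. by rewrite /dot -scalemxAr mxE. Qed.

Lemma dot0r u : dot u 0 = 0.
Proof. by rewrite /dot mulmx0 mxE. Qed.

Lemma dot_sumr u (I : finType) (F : I -> 'cV[R]_n) :
  dot u (\sum_i F i) = \sum_i dot u (F i).
Proof. by rewrite /dot mulmx_sumr summxE. Qed.

Lemma dot_ge0 u : 0 <= dot u u.
Proof. by rewrite dotE sumr_ge0 // => i _; rewrite -expr2 sqr_ge0. Qed.

Lemma dot_eq0 u : (dot u u == 0) = (u == 0).
Proof.
apply/eqP/eqP => [|->]; last exact: dot0r.
rewrite dotE => /eqP; rewrite psumr_eq0 => [/allP u0|i _]; last first.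
  by rewrite -expr2 sqr_ge0.
apply/matrixP => i j; rewrite ord1 mxE; apply/eqP.
by have := u0 i (mem_index_enum _); rewrite mulf_eq0 orbb.
Qed.

Lemma dot_gt0 u : (0 < dot u u) = (u != 0).
Proof. by rewrite lt_def dot_eq0 dot_ge0 andbT. Qed.

Lemma enorm_gt0 u : (0 < enorm u) = (u != 0).
Proof. by rewrite /enorm sqrtr_gt0 dot_gt0. Qed.

Lemma enorm_normalize u : u != 0 -> enorm (normalize u) = 1.
Proof.
move=> u0; rewrite /enorm /normalize dotZl dotZr mulrA -expr2.
rewrite -(sqr_sqrtr (dot_ge0 u)) -/(enorm u) -exprMn mulVf ?expr1n ?sqrtr1 //.
by rewrite gt_eqF ?enorm_gt0.
Qed.

End Dot.

(** * Maxima of finite sequences *)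

Section SeqMax.
Context {R : realType}.
Implicit Types (l : seq R) (c x : R).

Lemma le_seq_max l x : x \in l -> x <= seq_max l.
Proof. by move=> xl; rewrite /seq_max; apply: le_bigmax_seq. Qed.

(** Nonemptiness makes the default value an entry of [l]; on the empty sequence the maximum is 0,
    which need not lie below [c]. *)
Lemma seq_max_le l c :
  l != [::] -> (forall x, x \in l -> x <= c) -> seq_max l <= c.
Proof.
move=> l0 lc; rewrite /seq_max big_seq; apply: bigmax_le => [|x xl].
  by apply: lc; case: l l0 => // x l _; rewrite mem_head.
exact: lc.
Qed.

End SeqMax.

(** * Vertices of the polytope cut out by [Q] *)

Section Vertex.
Context {R : realType} {n : nat} (Q : seq 'cV[R]_n).
Hypothesis Q_pos : forall w, w != 0 -> exists2 q, q \in Q & 0 < dot w q.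

(** A ratio test: [t] is the least quotient of slack by slope among the constraints that increase
    along [w]. By [Q_pos] there is at least one. *)
Lemma activate_constraint (v w : 'cV[R]_n) :
  (forall q, q \in Q -> dot v q <= 1) -> w != 0 ->
  exists t, [/\ 0 <= t, forall q, q \in Q -> dot (v + t *: w) q <= 1 &
    exists q, [/\ q \in Q, 0 < dot w q & dot (v + t *: w) q = 1]].
Proof.
move=> vQ /Q_pos[q0 q0Q wq0].
pose p (i : 'I_(size Q)) := 0 < dot w (tnth (in_tuple Q) i).
pose F (i : 'I_(size Q)) :=
  (1 - dot v (tnth (in_tuple Q) i)) / dot w (tnth (in_tuple Q) i).
have /tnthP[i0 q0E] : q0 \in in_tuple Q by [].
have pi0 : p i0 by rewrite /p -q0E.
case: (arg_minP F pi0) => i pi Fi.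
have tQ j : tnth (in_tuple Q) j \in Q by exact: (mem_tnth j (in_tuple Q)).
have Fi0 : 0 <= F i by rewrite divr_ge0 ?subr_ge0 ?vQ // ltW.
exists (F i); split=> //; last first.
  exists (tnth (in_tuple Q) i); split=> //.
  by rewrite dotDl dotZl /F divfK ?gt_eqF // addrC subrK.
move=> q qQ; have /tnthP[j ->] : q \in in_tuple Q by [].
(* Increasing constraints are controlled by minimality of [F i]; the others cannot grow, as the step
   is nonnegative. *)
rewrite dotDl dotZl; have [wj|wj] := ltP 0 (dot w (tnth (in_tuple Q) j)).
  by rewrite addrC -lerBrDr -ler_pdivlMr //; apply: Fi.
by rewrite -[leRHS]addr0 lerD ?vQ // mulr_ge0_le0.
Qed.

(* As long as the active constraints do not span, moving in a direction [w]
   orthogonal to them, with [dot v w >= 0], keeps them active, does not shorten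
   [v] and eventually activates one more. *)
Lemma exists_longer_vertex (v : 'cV[R]_n) :
  (forall q, q \in Q -> dot v q <= 1) ->
  exists v', [/\ forall q, q \in Q -> dot v' q <= 1, dot v v <= dot v' v' &
    forall w, (forall q, q \in Q -> dot v' q = 1 -> dot w q = 0) -> w = 0].
Proof.
(* Induction on the number of inactive constraints. *)
have [k] := ubnP (count (fun q => dot v q != 1) Q).
elim: k v => // k IHk v /ltnSE-lek vQ.
have [spanning|] := pselect (forall w,
    (forall q, q \in Q -> dot v q = 1 -> dot w q = 0) -> w = 0).
  by exists v; split.
move=> /existsNP[w0 /not_implyP[w0Q /eqP w0_neq0]].
(* Orthogonality to the active constraints survives a change of sign, so the sign of [w] can be
   chosen freely. *)
have [w [wQ w_neq0 vw]] : exists w, [/\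
    forall q, q \in Q -> dot v q = 1 -> dot w q = 0, w != 0 & 0 <= dot v w].
  have [vw0|/ltW vw0] := leP 0 (dot v w0); first by exists w0.
  exists (-1 *: w0); split=> [q qQ vq||].
  - by rewrite dotZl w0Q // mulr0.
  - by rewrite scaleN1r oppr_eq0.
  - by rewrite dotZr mulN1r oppr_ge0.
have [t [t0 tQ [q1 [q1Q wq1 tq1]]]] := activate_constraint vQ w_neq0.
have keep q : q \in Q -> dot v q = 1 -> dot (v + t *: w) q = 1.
  by move=> qQ vq; rewrite dotDl dotZl vq wQ // mulr0 addr0.
have [|//|v' [v'Q le_vv' v'_spanning]] := IHk (v + t *: w).
  (* By [keep], the constraints still inactive are among those inactive before. The inclusion is
     strict: [q1] is now active, but was not, since otherwise [dot w q1] would be 0. *)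
  apply: leq_trans lek; rewrite -!size_filter.
  have -> : [seq q <- Q | dot (v + t *: w) q != 1] =
            [seq q <- [seq q <- Q | dot v q != 1] | dot (v + t *: w) q != 1].
    rewrite -filter_predI; apply: eq_in_filter => q qQ /=.
    by case: (dot v q =P 1) => [/keep->|]; rewrite ?eqxx ?andbT.
  rewrite size_filter -count_predT ltn_neqAle sub_count // andbT.
  rewrite -all_count; apply/negP => /allP /(_ q1).
  rewrite mem_filter q1Q andbT /= tq1 eqxx => /(_ _)/negP; apply=> //.
  by apply/eqP => /(wQ _ q1Q) wq10; rewrite wq10 ltxx in wq1.
exists v'; split=> //; apply: le_trans le_vv'.
(* The squared length grows by 2t(v . w) + t^2 (w . w), a sum of nonnegative terms. *)
rewrite !dotDl !dotDr !dotZl !dotZr [dot w v]dotC -addrA lerDl.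
by rewrite !addr_ge0 ?mulr_ge0 // dot_ge0.
Qed.

End Vertex.

(** * Bases and the vector that the algorithm attaches to them *)

Section Bases.
Context {R : realType} {n : nat}.
Implicit Types B : n.-tuple 'cV[R]_n.

(** The matrix [M] with the vectors of [A] as rows kills no nonzero column, hence has rank [n], and
    [n] independent rows of it form a basis. *)
Lemma spanning_has_basis (A : seq 'cV[R]_n) :
  (forall w, (forall q, q \in A -> dot w q = 0) -> w = 0) ->
  exists2 B : n.-tuple 'cV[R]_n, basis_of {:'cV[R]_n} B & {subset B <= A}.
Proof.
move=> A_spanning; pose M := \matrix_(i < size A, j < n) A`_i j 0.
have M_full : row_full M.
  rewrite /row_full -mxrank_tr; apply: inj_row_free => v vM0.
  rewrite -[v]trmxK; apply/eqP; rewrite trmx_eq0; apply/eqP.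
  apply: A_spanning => q /(nthP 0)[i iA <-].
  have /matrixP/(_ 0 (Ordinal iA)) := vM0; rewrite !mxE => <-.
  by rewrite dotE; apply: eq_bigr => j _; rewrite !mxE.
pose B := [tuple A`_(fullrankfun M_full i) | i < n].
have B_tnth (i : 'I_n) : B`_i = A`_(fullrankfun M_full i).
  by rewrite -tnth_nth tnth_mktuple.
exists B; last first.
  by move=> _ /mapP[i _ ->]; rewrite mem_nth.
rewrite basisEfree subvf dimvf dim_matrix size_tuple mulr1 leqnn !andbT.
apply/freeP => k k0 i.
have /row_free_inj : row_free (rowsub (fullrankfun M_full) M).
  exact: fullrowsub_free.
move=> /(_ _ (\row_j k j) 0); rewrite mul0mx => /(_ _)/matrixP/(_ 0 i).
rewrite !mxE; apply; apply/matrixP => a j; rewrite !mxE.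
have /matrixP/(_ j 0) := k0; rewrite summxE mxE => kj; apply: etrans kj.
by apply: eq_bigr => l _; rewrite !mxE B_tnth.
Qed.

Lemma cols_basis_unit B : basis_of {:'cV[R]_n} B -> cols B \in unitmx.
Proof.
move=> /basis_free/freeP B_free; rewrite -unitmx_tr -row_free_unit.
apply: inj_row_free => v vB0; apply/matrixP => i j; rewrite ord1 mxE.
apply: (B_free (v 0)); apply/matrixP => a b.
have /matrixP/(_ 0 a) := vB0; rewrite !mxE ord1 summxE => va; apply: etrans va.
by apply: eq_bigr => l _; rewrite !mxE -tnth_nth.
Qed.

Lemma gramE m (B : m.-tuple 'cV[R]_n) : gram B = (cols B)^T *m cols B.
Proof.
apply/matrixP => i j; rewrite !mxE dotE.
by apply: eq_bigr => k _; rewrite !mxE.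
Qed.

Lemma cols_tr_mul m (B : m.-tuple 'cV[R]_n) (x : 'cV[R]_n) i :
  ((cols B)^T *m x) i 0 = dot x (tnth B i).
Proof. by rewrite dotC dotE mxE; apply: eq_bigr => k _; rewrite !mxE. Qed.

Lemma basis_equidistant B : basis_of {:'cV[R]_n} B ->
  exists x : 'cV[R]_n, forall b, b \in B -> dot x b = 1.
Proof.
move=> /cols_basis_unit B_unit; exists ((invmx (cols B))^T *m const_mx 1).
move=> _ /tnthP[i ->]; rewrite -cols_tr_mul mulmxA -trmx_mul mulVmx //.
by rewrite trmx1 mul1mx mxE.
Qed.

(** Write B for [cols B] and 1 for the all-ones vector. From B^T x = 1 and G = B^T B it follows that
    1^T G^-1 1 = x^T x, so [basis_gamma B] is the inverse of the norm of x, while B^-T 1 = x. *)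
Lemma basis_vec_normalize B (x : 'cV[R]_n) :
  basis_of {:'cV[R]_n} B -> (forall b, b \in B -> dot x b = 1) ->
  basis_vec B = normalize x.
Proof.
move=> /cols_basis_unit B_unit xB.
have Bx : (cols B)^T *m x = const_mx 1.
  by apply/matrixP => i j; rewrite ord1 cols_tr_mul mxE xB ?mem_tnth.
have invBx : (invmx (cols B))^T *m const_mx 1 = x.
  by rewrite -Bx mulmxA -trmx_mul mulmxV // trmx1 mul1mx.
have invGx : invmx (gram B) *m const_mx 1 = invmx (cols B) *m x.
  have <- : gram B *m (invmx (cols B) *m x) = const_mx 1.
    by rewrite gramE -mulmxA mulKVmx.
  by rewrite mulKmx // gramE unitmx_mul unitmx_tr B_unit.
rewrite /basis_vec -scalemxAr invBx /normalize /basis_gamma div1r /enorm.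
congr ((Num.sqrt _)^-1 *: _).
by rewrite -mulmxA invGx -Bx trmx_mul trmxK -mulmxA mulKVmx.
Qed.

Lemma enorm_basis_vec B :
  (0 < n)%N -> basis_of {:'cV[R]_n} B -> enorm (basis_vec B) = 1.
Proof.
move=> n_gt0 B_basis; have [x xB] := basis_equidistant B_basis.
rewrite (basis_vec_normalize B_basis xB) enorm_normalize //.
apply/eqP => x0; have := xB _ (mem_tnth (Ordinal n_gt0) B).
by rewrite x0 dotC dot0r => /esym/eqP; rewrite oner_eq0.
Qed.

End Bases.

(** * Comparison of the algorithm with the cosine measure *)

Section Algorithm.
Context {R : realType} {n s : nat}.
Implicit Types (P Q : s.-tuple 'cV[R]_n) (B : n.-tuple 'cV[R]_n).

Lemma basis_maxE Q B :
  basis_max Q B = seq_max [seq dot (basis_vec B) q | q <- Q].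
Proof.
rewrite /basis_max; congr seq_max.
rewrite -[in RHS](map_tnth_enum Q) -map_comp; apply: eq_map => i /=.
by rewrite dotE mxE; apply: eq_bigr => j _; rewrite !mxE.
Qed.

Lemma seq_max_unit_vectors P (u : 'cV[R]_n) :
  seq_max [seq dot u d / enorm d | d <- P] =
  seq_max [seq dot u q | q <- unit_vectors P].
Proof.
rewrite /= -map_comp; congr seq_max; apply: eq_map => d /=.
by rewrite /normalize dotZr mulrC.
Qed.

(** If [w] had no positive product with a vector of [P], writing [w] as a nonnegative combination of
    them would give [dot w w <= 0]. *)
Lemma positive_spanning_dot_gt0 P (w : 'cV[R]_n) :
  positive_spanning_set P -> w != 0 ->
  exists2 q, q \in unit_vectors P & 0 < dot w q.
Proof.
move=> [_ _ P_span] w0.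
have [a [a_ge0 wE]] : pspan P w by rewrite P_span.
have [[i wPi]|wP] := pselect (exists i, 0 < dot w (tnth P i)).
  exists (normalize (tnth P i)); first by rewrite map_f ?mem_tnth.
  rewrite dotZr mulr_gt0 // invr_gt0 enorm_gt0.
  by apply: contraTneq wPi => ->; rewrite dot0r ltxx.
suff : dot w w <= 0 by rewrite leNgt dot_gt0 w0.
rewrite {2}wE dot_sumr sumr_le0 // => i _; rewrite dotZr mulr_ge0_le0 //.
by rewrite leNgt; apply/negP => wPi; apply: wP; exists i.
Qed.

Lemma exists_better_basis Q (u : 'cV[R]_n) :
  (forall w, w != 0 -> exists2 q, q \in Q & 0 < dot w q) -> enorm u = 1 ->
  exists2 B, bases Q B & basis_max Q B <= seq_max [seq dot u q | q <- Q].
Proof.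
move=> Q_pos u1; set c := seq_max _.
have [q0 q0Q uq0] : exists2 q, q \in Q & 0 < dot u q.
  by apply: Q_pos; rewrite -enorm_gt0 u1.
have uQ q : q \in Q -> dot u q <= c by move=> qQ; rewrite le_seq_max ?map_f.
have c_gt0 : 0 < c := lt_le_trans uq0 (uQ _ q0Q).
have [|v [vQ v_long v_spanning]] :=
    @exists_longer_vertex _ _ _ Q_pos (c^-1 *: u).
  by move=> q /uQ; rewrite dotZl mulrC ler_pdivrMr // mul1r.
have cv : c^-1 <= enorm v.
  move: v_long; rewrite -ler_sqrt ?dot_ge0 // dotZl dotZr mulrA -expr2.
  rewrite sqrtrM ?sqr_ge0 // -/(enorm u) u1 mulr1 sqrtr_sqr.
  by rewrite gtr0_norm // invr_gt0.
have v_gt0 : 0 < enorm v by rewrite (lt_le_trans _ cv) ?invr_gt0.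
(* The basis is drawn from the constraints active at [v], so that [basis_vec B] is [normalize v]. *)
have [|B B_basis BA] := @spanning_has_basis _ _ [seq q <- Q | dot v q == 1].
  move=> w wA; apply: v_spanning => q qQ vq.
  by apply: wA; rewrite mem_filter vq eqxx.
have BQ b : b \in B -> b \in Q /\ dot v b = 1.
  by move=> /BA; rewrite mem_filter => /andP[/eqP].
exists B; first by split=> // b /BQ[].
rewrite basis_maxE (@basis_vec_normalize _ _ _ v B_basis) => [|b /BQ[]//].
apply: seq_max_le => [|_ /mapP[q qQ ->]].
  by rewrite -size_eq0 size_map -lt0n -has_predT; apply/hasP; exists q0.
rewrite dotZl (@le_trans _ _ (enorm v)^-1) //.
  by rewrite ler_piMr ?vQ // invr_ge0 ltW.
by rewrite -[leRHS]invrK lef_pV2 // posrE ?invr_gt0.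
Qed.

(** Every basis is [tup f] for some [f] in a finite type of index functions, which reduces the
    minimum to one over that type. *)
Lemma basis_max_minimum Q :
  (exists B, bases Q B) -> exists c, cm_algorithm_returns Q c.
Proof.
pose tup (f : {ffun 'I_n -> 'I_s}) := [tuple tnth Q (f i) | i < n].
have tupP B : bases Q B -> exists2 f, tup f = B & basis_of {:'cV[R]_n} (tup f).
  move=> [B_basis BQ].
  have /choice[f fB] : forall i, exists j, tnth B i = tnth Q j.
    by move=> i; apply/tnthP; rewrite BQ ?mem_tnth.
  have fE : tup (finfun f) = B.
    by apply: eq_from_tnth => i; rewrite tnth_mktuple ffunE fB.
  by exists (finfun f); rewrite ?fE.
move=> [_ /tupP[f0 _ f0_basis]].
case: (@arg_minP _ _ _ f0 (fun f => basis_of fullv (tup f))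
  (fun f => basis_max Q (tup f)) f0_basis) => f f_basis f_min.
exists (basis_max Q (tup f)); split=> [|_ [_ /tupP[g <- /f_min le_fg] <- //]].
exists (tup f) => //; split=> // _ /tnthP[i ->].
by rewrite tnth_mktuple mem_tnth.
Qed.

End Algorithm.

Theorem theorem19 (R : realType) (n s : nat) (n_gt0 : (0 < n)%N)
    (P : s.-tuple 'cV[R]_n) (hP : positive_spanning_set P) :
  exists c : R,
    is_cosine_measure P c /\ cm_algorithm_returns (unit_vectors P) c.
Proof.
have Q_pos w := @positive_spanning_dot_gt0 _ _ _ P w hP.
have better u := @exists_better_basis _ _ _ (unit_vectors P) u Q_pos.
have ones_neq0 : const_mx 1 != 0 :> 'cV[R]_n.
  apply/eqP => /matrixP/(_ (Ordinal n_gt0) 0)/eqP.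
  by rewrite !mxE oner_eq0.
have [c [[B B_basis Bc] c_min]] :
    exists c, cm_algorithm_returns (unit_vectors P) c.
  (* Any unit vector yields a basis through [better]; since [n] is positive, the normalized all-ones
     vector is one. *)
  apply: basis_max_minimum.
  by have [B ? _] := better _ (enorm_normalize ones_neq0); exists B.
exists c; split; last by split=> //; exists B.
split=> [|_ [u u1 <-]].
  (* The minimizing [basis_vec B] is itself a unit vector, so the cosine measure attains [c];
     [better] gives the lower bound. *)
  exists (basis_vec B); first exact: enorm_basis_vec B_basis.1.
  by rewrite seq_max_unit_vectors -basis_maxE.
rewrite seq_max_unit_vectors; have [B' B'_basis] := better u u1.
by apply: le_trans; apply: c_min; exists B'.
Qed.
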